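(* Consider the bilevel problem with real discounts (P): $$\max_{y\in\mathbb{R}^n}\ \sum_{i=1}^n f_i(N_i)\quad\text{s.t. } N_i\le N_i^C\ \ \forall i\in[n],$$ where $N=\sum_{k=1}^K u_k^*$ and, for every $k\in[K]$, $u_k^*$ is a solution of $\max_{u_k\in F_k}\langle \rho_k+y,u_k\rangle$. This problem can be solved by the following three steps. 1. Find an optimal solution $N^*$ of $\max\{\sum_{i=1}^n f_i(N_i) : N\in\sum_{k=1}^K F_k,\ N_i\le N_i^C\ \forall i\in[n]\}$. 2. Find an optimal solution $(u_1^*,\dots,u_K^* )$ of $\max\{\sum_{k=1}^K\langle\rho_k,u_k\rangle : u_1\in F_1,\dots,u_K\in F_K,\ \sum_{k=1}^K u_k=N^*\}$. 3. Find a vector $y^*\in\mathbb{R}^n$ such that for every $k\in[K]$, $u_k^*\in\arg\max_{u_k\in F_k}\langle\rho_k+y^*,u_k\rangle$. That is: for every $N^*$ optimal in step 1, the problem of step 2 has an optimal solution; for every optimal solution $(u_k^* )_k$ of step 2, a vector $y^*$ as in step 3 exists; and every such $y^*$ (together with the responses $u_k^*$ and $N^*=\sum_k u_k^*$) is an optimal solution of (P).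
   Context: $[m]=\{1,\dots,m\}$. Let $n,K\ge 1$ be integers. For each $k\in[K]$ let $\mathcal{J}_k\subset[n]$, let $R_k$ be a nonnegative integer, and let $\rho_k\in(\mathbb{R}\cup\{-\infty\})^n$ with $\rho_k(i)=-\infty$ if and only if $i\in\mathcal{J}_k$. Set $F_k=\{u\in\{0,1\}^n : \sum_{i=1}^n u(i)=R_k,\ u(i)=0\ \forall i\in\mathcal{J}_k\}$. In scalar products $\langle\cdot,\cdot\rangle$ the convention $(-\infty)\cdot 0=0$ is used. $\sum_k F_k$ is the Minkowski sum. For each $i\in[n]$, $N_i^C$ is a nonnegative integer and $f_i(x)=x\,s_i(x)$ with $s_i:\mathbb{R}_+\to\mathbb{R}$ nonincreasing and concave on $[0,N_i^C]$. In the bilevel problem, when the lower-level solutions are not unique, the choice of $u_k^*$ among them is part of the optimization (optimistic formulation): a solution is a vector $y$ together with a choice of lower-level solutions $u_k^*$ giving $N$. *)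

(* Defs.v *)
From HB Require Import structures.
From mathcomp Require Import all_boot all_order all_algebra.
From mathcomp Require Import all_classical all_reals all_analysis.

Set Implicit Arguments.
Unset Strict Implicit.
Unset Printing Implicit Defensive.

Import Order.TTheory GRing.Theory Num.Theory.

Local Open Scope classical_set_scope.
Local Open Scope ring_scope.

Definition is_maximizer (disp : Order.disp_t) (V : porderType disp) (T : Type)
    (D : set T) (g : T -> V) (x : T) : Prop :=
  D x /\ forall z, D z -> (g z <= g x)%O.

Definition concave_on (R : realType) (D : set R) (f : R -> R) : Prop :=
  @convex_function R R^o D (fun x => - f x).

Definition minkowski_sum (V : nmodType) (I : finType) (F : I -> set V) :
    set V :=
  [set \sum_k u k | u in [set u : I -> V | forall k, F k (u k)]].

(* As [0 * -oo = 0] in [\bar R], this is the scalar product with the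
   convention (-oo) * 0 = 0. *)
Definition edot (R : realType) (n : nat) (r : {ffun 'I_n -> \bar R})
    (u : {ffun 'I_n -> nat}) : \bar R :=
  (\sum_(i < n) r i * ((u i)%:R)%:E)%E.

Definition discount (R : realType) (n : nat) (r : {ffun 'I_n -> \bar R})
    (y : {ffun 'I_n -> R}) : {ffun 'I_n -> \bar R} :=
  [ffun i => (r i + (y i)%:E)%E].

Definition choices (n : nat) (J : {set 'I_n}) (r : nat) :
    set {ffun 'I_n -> nat} :=
  [set u | [/\ forall i, u i = 0%N \/ u i = 1%N,
               (\sum_(i < n) u i)%N = r
             & forall i, i \in J -> u i = 0%N]].

Definition revenue (R : realType) (n : nat) (s : 'I_n -> R -> R)
    (N : {ffun 'I_n -> nat}) : R :=
  \sum_(i < n) (N i)%:R * s i (N i)%:R.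

Definition under_capacity (n : nat) (NC : 'I_n -> nat) :
    set {ffun 'I_n -> nat} :=
  [set N | forall i, (N i <= NC i)%N].

Definition lower_optimal (R : realType) (n K : nat)
    (F : 'I_K -> set {ffun 'I_n -> nat}) (rho : 'I_K -> {ffun 'I_n -> \bar R})
    (y : {ffun 'I_n -> R}) (u : 'I_K -> {ffun 'I_n -> nat}) : Prop :=
  forall k, is_maximizer (F k) (edot (discount (rho k) y)) (u k).

(* Optimistic formulation: the lower-level responses [u] are decision
   variables, along with the discounts [y]. *)
Definition bilevel_optimal (R : realType) (n K : nat)
    (F : 'I_K -> set {ffun 'I_n -> nat}) (rho : 'I_K -> {ffun 'I_n -> \bar R})
    (NC : 'I_n -> nat) (s : 'I_n -> R -> R) (y : {ffun 'I_n -> R})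
    (u : 'I_K -> {ffun 'I_n -> nat}) : Prop :=
  is_maximizer
    [set p : {ffun 'I_n -> R} * ('I_K -> {ffun 'I_n -> nat}) |
       lower_optimal F rho p.1 p.2 /\ under_capacity NC (\sum_k p.2 k)]
    (fun p => revenue s (\sum_k p.2 k)) (y, u).

Definition step1_optimal (R : realType) (n K : nat)
    (F : 'I_K -> set {ffun 'I_n -> nat})
    (NC : 'I_n -> nat) (s : 'I_n -> R -> R) (N : {ffun 'I_n -> nat}) : Prop :=
  is_maximizer (minkowski_sum F `&` under_capacity NC) (revenue s) N.

Definition step2_optimal (R : realType) (n K : nat)
    (F : 'I_K -> set {ffun 'I_n -> nat}) (rho : 'I_K -> {ffun 'I_n -> \bar R})
    (N : {ffun 'I_n -> nat}) (u : 'I_K -> {ffun 'I_n -> nat}) : Prop :=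
  is_maximizer
    [set v : 'I_K -> {ffun 'I_n -> nat} |
       (forall k, F k (v k)) /\ \sum_k v k = N]
    (fun v => (\sum_k edot (rho k) (v k))%E) u.

(* Main.v *)
(* In terms of exchanges, [ustar] is optimal in step 2 only if no simple cycle
   of single-item exchanges (each made inside one [F k], the cycle as a whole
   leaving the total unchanged) has positive gain.  Hence the exchange digraph
   on the items has no negative cycle and admits a potential [y]; under the
   discounts [y], no exchange inside one [F k] is profitable, which is
   optimality in [F k].  Finally, every feasible point of the bilevel problem is
   feasible in step 1. *)
Require Import Defs.
From mathcomp Require Import all_boot all_order all_algebra.
From mathcomp Require Import all_classical all_reals all_analysis.
From mathcomp Require Import lra.

Import Order.TTheory GRing.Theory Num.Theory.

Local Open Scope classical_set_scope.
Local Open Scope ring_scope.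

(** [X] itself need not be finite: [D] lies in the image of the finite type [T], so a best preimage
    provides the maximizer. *)
Lemma exists_maximizer {disp : Order.disp_t} {V : orderType disp} {T : finType}
    {X : Type} (h : T -> X) (D : set X) (g : X -> V) :
  D `<=` range h -> D !=set0 -> exists x, is_maximizer D g x.
Proof.
move=> Dh [x0 Dx0]; have [t0 _ ht0] := Dh _ Dx0.
have Pt0 : `[< D (h t0) >] by apply/asboolP; rewrite ht0.
case: (@Order.TotalTheory.arg_maxP _ _ _ t0 (fun t => `[< D (h t) >])
  (g \o h) Pt0) => t /asboolP Dt tmax.
exists (h t); split=> // z Dz; have [t' _ ht'] := Dh _ Dz.
by rewrite -ht'; apply: tmax; apply/asboolP; rewrite ht'.
Qed.

Fixpoint path_weight {T : Type} {R : nmodType} (c : T -> T -> R) (x : T)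
    (p : seq T) : R :=
  if p is y :: p' then c x y + path_weight c y p' else 0.

Lemma path_weight_cat {T : Type} {R : nmodType} (c : T -> T -> R) (x : T)
    (p q : seq T) :
  path_weight c x (p ++ q) = path_weight c x p + path_weight c (last x p) q.
Proof. by elim: p x => [|y p IHp] x /=; rewrite ?add0r // IHp addrA. Qed.

Lemma sum_next {T : eqType} {R : nmodType} (c : T -> T -> R) (x : T)
    (p : seq T) : uniq (x :: p) ->
  \sum_(z <- x :: p) c z (next (x :: p) z) =
  path_weight c x p + c (last x p) x.
Proof.
(* The point to which [next] wraps around is frozen as [x0], so that the induction on [p] may move
   the head. *)
rewrite /next; move: {3 7}x => x0.
elim: p x => [|y p IHp] x; first by rewrite big_seq1 /= eqxx add0r.
rewrite cons_uniq => /andP[xp yp]; rewrite big_cons /= eqxx -addrA.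
congr (_ + _); rewrite -(IHp y yp); apply: eq_big_seq => z zp.
by case: eqP zp xp => // -> ->.
Qed.

(* The potential of [x] is the least weight of a simple path from [x]. *)
Lemma exists_potential {T : finType} {R : realDomainType} (e : rel T)
    (c : T -> T -> R) :
  (forall x p, path e x p -> uniq (x :: p) -> e (last x p) x ->
     0 <= path_weight c x p + c (last x p) x) ->
  exists y : T -> R, forall i j, e i j -> y i <= c i j + y j.
Proof.
(* A simple path has fewer than [#|T|] arcs, so the minimum ranges over a finite type; the empty
   path is always admissible. *)
move=> cyc; pose P x (p : #|T|.-bseq T) := path e x p && uniq (x :: p).
pose m x := [arg min_(p < [bseq] | P x p) path_weight c x p]%O.
have mP x : P x (m x) /\
    forall p : seq T, path e x p -> uniq (x :: p) ->
      path_weight c x (m x) <= path_weight c x p.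
  rewrite /m; case: Order.TotalTheory.arg_minP => // q Pq qmin; split=> // p ep up.
  have sp : (size p <= #|T|)%N.
    by apply/ltnW; move/card_uniqP: up => /= <-; exact: max_card.
  by have := qmin (Bseq sp); apply; rewrite /P /= ep.
exists (fun x => path_weight c x (m x)) => i j eij.
have [/andP[ej uj] _] := mP j; have [_ minj] := mP i.
(* Off the path [m j], [i] can be prepended to it. Otherwise [m j] is cut at [i]: the first piece
   and the arc from [i] to [j] form a cycle of nonnegative weight, and the rest is a simple path
   from [i]. *)
have [ij|nij] := boolP (i \in j :: m j); last first.
  by apply: (minj (j :: m j)); rewrite ?cons_uniq ?nij //= eij ej.
move: (bseqval (m j)) ij ej uj => p ij.
case/splitPl: ij => p1 p2 lastp1.
rewrite cat_path -cat_cons cat_uniq path_weight_cat lastp1.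
move=> /andP[ep1 ep2] /and3P[up1 disj up2].
have := cyc j p1 ep1 up1; rewrite lastp1 => /(_ eij).
suff /minj : uniq (i :: p2) by move=> /(_ ep2); lra.
rewrite cons_uniq up2 andbT; apply: contra disj => ip2.
by apply/hasP; exists i => //; rewrite -lastp1 mem_last.
Qed.

(** An infinite coefficient is harmless where [u] vanishes: its term is 0 on both sides. Comparisons
    of scalar products thus move from [\bar R] to [R]. *)
Lemma edotE {R : realType} {n : nat} (r : {ffun 'I_n -> \bar R})
    (u : {ffun 'I_n -> nat}) :
  (forall i, r i \is a fin_num \/ u i = 0%N) ->
  edot r u = (\sum_(i < n) fine (r i) * (u i)%:R)%:E.
Proof.
move=> ru; rewrite /edot -sumEFin; apply: eq_bigr => i _.
have [ri|->] := ru i; first by rewrite EFinM fineK.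
by rewrite mule0 mulr0.
Qed.

(* Compare both sums with those for the constant price [t] of a cheapest
   selected item, which are equal. *)
Lemma exchange_optimal {R : realDomainType} {n : nat} (J : {set 'I_n}) (r : nat)
    (p : 'I_n -> R) (u z : {ffun 'I_n -> nat}) :
  choices J r u -> choices J r z ->
  (forall i j, u i = 0%N -> i \notin J -> u j = 1%N -> p i <= p j) ->
  \sum_(i < n) p i * (z i)%:R <= \sum_(i < n) p i * (u i)%:R.
Proof.
move=> [u01 su uJ] [z01 sz zJ] uopt.
suff [t tP] : exists t, forall i, p i * (z i)%:R - p i * (u i)%:R <=
                                  t * (z i)%:R - t * (u i)%:R.
  rewrite -subr_le0 -sumrB (le_trans (ler_sum _ (fun i _ => tP i))) //.
  by rewrite sumrB -!mulr_sumr -!natr_sum su sz subrr.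
(* If [u] selects nothing, then [r] is 0, [z] selects nothing either, and any price works. *)
have [[j0 uj0]|nu] := pselect (exists j, u j = 1%N); last first.
  have u0 i : u i = 0%N by have [//|ui] := u01 i; case: nu; exists i.
  have r0 : r = 0%N by rewrite -su big1.
  exists 0 => i; rewrite u0; suff -> : z i = 0%N by rewrite !mulr0.
  move/eqP: sz; rewrite r0 sum_nat_eq0 => /forallP/(_ i)/eqP //.
pose j := [arg min_(j < j0 | u j == 1%N) p j]%O.
have [uj jmin] : u j = 1%N /\ forall i, u i = 1%N -> p j <= p i.
  rewrite /j; case: Order.TotalTheory.arg_minP; first exact/eqP.
  by move=> k /eqP uk kmin; split=> // i /eqP; exact: kmin.
exists (p j) => i; have [zi|zi] := z01 i; have [ui|ui] := u01 i.
- by rewrite zi ui !mulr0.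
- by rewrite zi ui !mulr0 !mulr1 !sub0r lerN2 jmin.
- rewrite zi ui !mulr0 !mulr1 !subr0; apply: uopt => //.
  by apply/negP => /zJ; rewrite zi.
- by rewrite zi ui !mulr1 !subrr.
Qed.

(* Along the cycle [s], each [x] replaces [next s x] in [u (a x)]. *)
Lemma cycle_exchange {R : realDomainType} {n K : nat} (J : 'I_K -> {set 'I_n})
    (r : 'I_K -> nat) (q : 'I_K -> 'I_n -> R) (u : 'I_K -> {ffun 'I_n -> nat})
    (s : seq 'I_n) (a : 'I_n -> 'I_K) :
  (forall k, choices (J k) (r k) (u k)) ->
  (forall v : 'I_K -> {ffun 'I_n -> nat}, (forall k, choices (J k) (r k) (v k)) ->
     \sum_k v k = \sum_k u k ->
     \sum_k \sum_(i < n) q k i * (v k i)%:R <=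
     \sum_k \sum_(i < n) q k i * (u k i)%:R) ->
  uniq s ->
  {in s, forall x, [/\ u (a x) x = 0%N, x \notin J (a x)
                     & u (a x) (next s x) = 1%N]} ->
  \sum_(x <- s) q (a x) x <= \sum_(x <- s) q (a x) (next s x).
Proof.
move=> uF uopt us aP.
(* Items entering [u k] and items leaving it; a leaving [i] is replaced by [prev s i]. One [k] may
   take part in several exchanges of the cycle. *)
pose gain k i := (i \in s) && (a i == k).
pose lose k i := (i \in s) && (a (prev s i) == k).
pose v k := [ffun i => if gain k i then 1%N else
                       if lose k i then 0%N else u k i].
have gainP k i : gain k i -> u k i = 0%N /\ i \notin J k.
  by move=> /andP[/aP[ui iJ _] /eqP <-].
have loseP k i : lose k i -> u k i = 1%N.
  move=> /andP[is_ /eqP <-]; have : prev s i \in s by rewrite mem_prev.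
  by move=> /aP[_ _]; rewrite next_prev.
have lose_next k i : lose k (next s i) = gain k i.
  by rewrite /lose /gain mem_next prev_next.
have next_bij : bijective (next s).
  by exists (prev s); [exact: prev_next|exact: next_prev].
(* No item both enters and leaves the same [u k], as its old value would be both 0 and 1. The
   additive form avoids truncated subtraction. *)
have vE k i : (v k i + lose k i = u k i + gain k i)%N.
  rewrite ffunE; case: ifP => [gi|_]; last first.
    by case: ifP => [/loseP ->|_]; rewrite !addn0.
  have [ui _] := gainP _ _ gi; rewrite ui.
  by case: (boolP (lose k i)) => // /loseP; rewrite ui.
have sum_ind (b : 'I_K) : (\sum_(k < K) (b == k) = 1)%N.
  by rewrite (bigD1 b) //= eqxx big1 // => k; rewrite eq_sym => /negbTE ->.
have vF k : choices (J k) (r k) (v k).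
  have [u01 su uJ] := uF k; split.
  - move=> i; rewrite ffunE; case: ifP => _; first by right.
    by case: ifP => _; [left|exact: u01].
  (* [next s] maps the items gained by [k] bijectively onto those it loses, so the cardinality is
     kept. *)
  - have : (\sum_(i < n) (v k i + lose k i) =
            \sum_(i < n) (u k i + gain k i))%N by apply: eq_bigr.
    rewrite !big_split /= su [X in (_ + X)%N = _](reindex (next s)) /=; last first.
      exact: onW_bij.
    by under [X in (_ + X)%N = _]eq_bigr do rewrite lose_next; move/addIn.
  - move=> i iJ; rewrite ffunE; case: ifP => [/gainP[_]|_]; first by rewrite iJ.
    by case: ifP => // _; exact: uJ.
have vsum : \sum_k v k = \sum_k u k.
  apply/ffunP => i; rewrite !sum_ffunE.
  (* Each item of the cycle is gained by exactly one [k] and lost by exactly one. *)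
  have : (\sum_(k < K) (v k i + lose k i) =
          \sum_(k < K) (u k i + gain k i))%N by apply: eq_bigr.
  rewrite !big_split /= /lose /gain; case: (i \in s) => /=.
    by rewrite !sum_ind => /addIn.
  by rewrite !big1_eq !addn0.
have sum_gain (f : 'I_n -> 'I_n) :
    \sum_(k < K) \sum_(i < n) q k (f i) * (gain k i)%:R =
    \sum_(x <- s) q (a x) (f x).
  rewrite exchange_big /= [RHS]big_uniq //= [RHS]big_mkcond /=.
  apply: eq_bigr => i _; rewrite /gain; case: (i \in s) => /=; last first.
    by rewrite big1 // => k _; rewrite mulr0.
  rewrite (bigD1 (a i)) //= eqxx mulr1 big1 ?addr0 // => k.
  by rewrite eq_sym => /negbTE ->; rewrite mulr0.
have := uopt v vF vsum.
rewrite -(sum_gain id) -(sum_gain (next s)).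
have -> : \sum_(k < K) \sum_(i < n) q k (next s i) * (gain k i)%:R =
          \sum_(k < K) \sum_(i < n) q k i * (lose k i)%:R.
  apply: eq_bigr => k _; rewrite [RHS](reindex (next s)) /=; last exact: onW_bij.
  by apply: eq_bigr => i _; rewrite lose_next.
have : \sum_(k < K) \sum_(i < n) q k i * (v k i)%:R +
       \sum_(k < K) \sum_(i < n) q k i * (lose k i)%:R =
       \sum_(k < K) \sum_(i < n) q k i * (u k i)%:R +
       \sum_(k < K) \sum_(i < n) q k i * (gain k i)%:R.
  rewrite -!big_split; apply: eq_bigr => k _; rewrite -!big_split.
  by apply: eq_bigr => i _; rewrite /= -!mulrDr -!natrD vE.
by lra.
Qed.

(** An arc from [i] to [j] weighs the least loss [q k j - q k i] among the [k] able to take [i] in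
    place of [j]; the potential inequality for this cheapest [k] implies it for all the others. *)
Lemma exists_supporting_prices {R : realDomainType} {n K : nat}
    (J : 'I_K -> {set 'I_n}) (r : 'I_K -> nat) (q : 'I_K -> 'I_n -> R)
    (u : 'I_K -> {ffun 'I_n -> nat}) :
  (0 < K)%N ->
  (forall k, choices (J k) (r k) (u k)) ->
  (forall v : 'I_K -> {ffun 'I_n -> nat}, (forall k, choices (J k) (r k) (v k)) ->
     \sum_k v k = \sum_k u k ->
     \sum_k \sum_(i < n) q k i * (v k i)%:R <=
     \sum_k \sum_(i < n) q k i * (u k i)%:R) ->
  exists y : 'I_n -> R, forall k i j,
    u k i = 0%N -> i \notin J k -> u k j = 1%N -> q k i + y i <= q k j + y j.
Proof.
move=> K_gt0 uF uopt; pose k0 := Ordinal K_gt0.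
pose A i j k := [&& u k i == 0%N, i \notin J k & u k j == 1%N].
pose e i j := [exists k, A i j k].
pose d i j k := q k j - q k i.
(* [a i j] is such a cheapest [k]; [k0] is a mere default for pairs without an arc. *)
have aP i j : {a | e i j -> A i j a & forall k, A i j k -> d i j a <= d i j k}.
  case: (boolP (e i j)) => [/existsP/sigW[k1 Ak1]|]; last first.
    by move/existsPn => nA; exists k0 => // k; rewrite (negbTE (nA k)).
  exists [arg min_(k < k1 | A i j k) d i j k]%O;
    by case: Order.TotalTheory.arg_minP.
pose a i j := s2val (aP i j).
have aA i j : e i j -> A i j (a i j) by exact: (s2valP (aP i j)).
have amin i j k : A i j k -> d i j (a i j) <= d i j k.
  exact: (s2valP' (aP i j)).
have [|y yP] := @exists_potential _ _ e (fun i j => d i j (a i j)); last first.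
  exists y => k i j ui iJ uj.
  have Ak : A i j k by rewrite /A ui uj iJ.
  have eij : e i j by apply/existsP; exists k.
  by have := yP i j eij; have := amin i j k Ak; rewrite /d; lra.
(* Performing each arc of the cycle in the [k] that attains its weight, the cycle weight is the
   total loss of a cyclic exchange. *)
move=> x p ep up elast; rewrite -(sum_next (fun i j => d i j (a i j))) //.
rewrite sumrB subr_ge0.
apply: (cycle_exchange J r q u (x :: p) (fun i => a i (next (x :: p) i))) => //.
have cyc : cycle e (x :: p) by rewrite /= rcons_path ep.
by move=> i /(next_cycle cyc)/aA/and3P[/eqP ? ? /eqP ?].
Qed.

Theorem theorem1 (R : realType) (n K : nat) (hn : (0 < n)%N) (hK : (0 < K)%N)
    (J : 'I_K -> {set 'I_n}) (r : 'I_K -> nat)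
    (rho : 'I_K -> {ffun 'I_n -> \bar R})
    (rho_lty : forall k i, rho k i <> +oo%E)
    (rho_J : forall k i, rho k i = -oo%E <-> i \in J k)
    (NC : 'I_n -> nat) (s : 'I_n -> R -> R)
    (s_noninc : forall i, {in `[0, (NC i)%:R] &, nonincreasing_fun (s i)})
    (s_concave : forall i, concave_on `[0, (NC i)%:R]%classic (s i)) :
  let F := fun k => choices (J k) (r k) in
  forall Nstar : {ffun 'I_n -> nat}, step1_optimal F NC s Nstar ->
    (exists u, step2_optimal F rho Nstar u) /\
    (forall ustar, step2_optimal F rho Nstar ustar ->
       (exists y : {ffun 'I_n -> R}, lower_optimal F rho y ustar) /\
       (forall ystar : {ffun 'I_n -> R}, lower_optimal F rho ystar ustar ->
          bilevel_optimal F rho NC s ystar ustar)).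
Proof.
move=> F Nstar [[[u0 u0F u0N] Ncap] Nmax].
have rho_fin k i : i \notin J k -> rho k i \is a fin_num.
  move=> iJ; rewrite fin_numE; apply/andP; split; apply/eqP.
    by move/rho_J; apply/negP.
  exact: rho_lty.
have fin_or_0 k v : F k v -> forall i, rho k i \is a fin_num \/ v i = 0%N.
  move=> [_ _ vJ] i; have [iJ|iJ] := boolP (i \in J k); last by left; exact: rho_fin.
  by right; exact: vJ.
split.
  (* Vectors in [F k] are 0-1, so feasible families come from finitely many boolean tables. *)
  apply: (exists_maximizer
    (fun (g : {ffun 'I_K -> {ffun 'I_n -> bool}}) k =>
       [ffun i => nat_of_bool (g k i)])); last by exists u0.
  move=> v [vF _]; exists [ffun k => [ffun i => v k i == 1%N]] => //.
  apply/funext => k; apply/ffunP => i; rewrite !ffunE.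
  by have [/(_ i)[] ->] := vF k.
move=> u [[uF uN] umax]; split.
  have [|y yP] := exists_supporting_prices J r (fun k i => fine (rho k i)) u hK uF.
    move=> v vF vu; have := umax v (conj vF (etrans vu uN)).
    rewrite (eq_bigr _ (fun k _ => edotE _ _ (fin_or_0 k _ (vF k)))).
    rewrite (eq_bigr _ (fun k _ => edotE _ _ (fin_or_0 k _ (uF k)))).
    by rewrite !sumEFin lee_fin.
  exists [ffun i => y i] => k; split=> [|z zF]; first exact: uF.
  have fin_or_0' v : F k v ->
      forall i, discount (rho k) [ffun i => y i] i \is a fin_num \/ v i = 0%N.
    move=> vF i; rewrite !ffunE.
    have [fi|->] := fin_or_0 k v vF i; last by right.
    by left; rewrite fin_numD fi.
  rewrite !edotE; [|exact: fin_or_0'..].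
  rewrite lee_fin; apply: (exchange_optimal _ _ _ _ _ (uF k) zF) => i j ui iJ uj.
  (* With [i] and [j] both outside [J k], the coefficients are finite and [fine] is additive on
     them. *)
  have jJ : j \notin J k.
    by apply/negP => jJ; have [_ _ /(_ j jJ)] := uF k; rewrite uj.
  by rewrite !ffunE !fineD ?rho_fin //=; exact: yP.
(* The upper objective sees the responses only through their total, so optimality of [Nstar]
   transfers whatever the supporting [y]. *)
move=> y yopt; split; first by split=> //=; rewrite uN.
move=> [y' u'] /= [u'opt u'cap]; rewrite uN; apply: Nmax; split=> //.
by exists u' => //= k; have [] := u'opt k.
Qed.
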